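(* Let $p,q\ge 1$ be real numbers, at least one of which is strictly bigger than one, and let $\Omega=\{(z_1,z_2)\in\mathbb{C}^2:|z_1|^p+|z_2|^q<1\}$. Then the complex Banach space $(\mathbb{C}^2,\|\cdot\|_\Omega)$ does not have Property P.
   Context: Here $\|\cdot\|_\Omega$ is the norm on $\mathbb{C}^2$ whose open unit ball is $\Omega$ (the Minkowski functional of $\Omega$). Let $X=(\mathbb{C}^n,\|\cdot\|_X)$. The dual $X^*$ is identified with $\mathbb{C}^n$ with norm $\|z\|_{X^*}=\sup\{|\sum_i z_i\overline{w_i}|:\|w\|_X\le 1\}$. For a complex $n\times n$ matrix $A$, $\|A\|_{X\to X^*}=\sup\{\|Ax\|_{X^*}:\|x\|_X\le1\}$, and $\|B\|_{X^*\to X}=\sup\{\|Bx\|_X:\|x\|_{X^*}\le1\}$. Write $A\ge0$ if $A$ is (Hermitian) positive semidefinite. Put $$\gamma(X):=\sup\{\langle A,B\rangle: A\ge 0,\ B\ge 0,\ \|A\|_{X\to X^*}\le1,\ \|B\|_{X^*\to X}\le1\},$$ where $A,B$ range over complex $n\times n$ matrices and $\langle A,B\rangle=\sum_{i,j}a_{ij}\overline{b_{ij}}$ is the Hilbert–Schmidt inner product. The space $X$ has Property P if and only if $\gamma(X)=1$. *)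

(* Defs.v *)
From HB Require Import structures.
From mathcomp Require Import all_boot all_order all_algebra.
From mathcomp Require Import all_classical all_reals all_analysis.
From mathcomp Require Import complex lra.

Set Implicit Arguments.
Unset Strict Implicit.
Unset Printing Implicit Defensive.

Import Order.TTheory GRing.Theory Num.Theory.

Local Open Scope classical_set_scope.
Local Open Scope ring_scope.
Local Open Scope sesquilinear_scope.

(* A complex Banach space structure on C^n, i.e. a norm on column vectors
   (completeness is automatic).  Norms take values in R itself, whereas the
   library's normed modules over R[i] have R[i]-valued norms. *)
Record banachCn (R : realType) (n : nat) := BanachCn {
  bnorm :> 'cV[R[i]]_n -> R ;
  bnormD : forall x y, bnorm (x + y) <= bnorm x + bnorm y ;
  bnormZ : forall (c : R[i]) x, bnorm (c *: x) = Normc.normc c * bnorm x ;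
  bnorm_eq0 : forall x, bnorm x = 0 -> x = 0 }.

(* The suprema below are taken in \bar R, where they always exist, rather than
   with the real-valued sup, which is 0 on unbounded sets. *)

Definition primal_norm (R : realType) n (X : banachCn R n) (x : 'cV[R[i]]_n) :
  \bar R := (X x)%:E.

Definition dual_norm (R : realType) n (X : banachCn R n) (z : 'cV[R[i]]_n) :
    \bar R :=
  ereal_sup [set (Normc.normc (\sum_i z i 0 * (w i 0)^*))%:E
            | w in [set w | X w <= 1]].

Definition op_norm (R : realType) n (N N' : 'cV[R[i]]_n -> \bar R)
    (A : 'M[R[i]]_n) : \bar R :=
  ereal_sup [set N' (A *m x) | x in [set x | (N x <= 1)%E]].

(* In R[i], 0 <= z means that z is real and nonnegative. *)
Definition psdmx (R : realType) n (A : 'M[R[i]]_n) : Prop :=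
  A \is hermsymmx /\ forall x : 'cV[R[i]]_n, 0 <= (x ^t* *m A *m x) 0 0.

Definition hs_inner (R : realType) n (A B : 'M[R[i]]_n) : R[i] :=
  \sum_i \sum_j A i j * (B i j)^*.

(* The inner product of two positive semidefinite matrices is real, so taking
   its real part only changes its type. *)
Definition gammaX (R : realType) n (X : banachCn R n) : \bar R :=
  ereal_sup [set r | exists A B : 'M[R[i]]_n,
    [/\ psdmx A, psdmx B,
        (op_norm (primal_norm X) (dual_norm X) A <= 1)%E,
        (op_norm (dual_norm X) (primal_norm X) B <= 1)%E
      & r = (complex.Re (hs_inner A B))%:E]].

Definition propertyP (R : realType) n (X : banachCn R n) : Prop :=
  gammaX X = 1%E.

Definition minkowski (R : realType) n (Om : set 'cV[R[i]]_n) (z : 'cV[R[i]]_n) :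
  R := inf [set t : R | 0 < t /\ Om ((t^-1)%:C%C *: z)].

Definition Omega (R : realType) (p q : R) : set 'cV[R[i]]_2 :=
  [set z | Normc.normc (z 0 0) `^ p + Normc.normc (z 1 0) `^ q < 1].

Lemma normc_ge0 (R : realType) (z : R[i]) : 0 <= Normc.normc z.
Proof. by case: z => a b; exact: sqrtr_ge0. Qed.

Lemma normc_real (R : realType) (t : R) : 0 <= t -> Normc.normc t%:C%C = t.
Proof. by move=> t0; rewrite /= expr0n addr0 sqrtr_sqr ger0_norm. Qed.

Section Minkowski.
Variables (R : realType) (n : nat) (Om : set 'cV[R[i]]_n).
Hypothesis Om_convex : forall (a b : R) x y, 0 <= a -> 0 <= b -> a + b = 1 ->
  Om x -> Om y -> Om (a%:C%C *: x + b%:C%C *: y).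
Hypothesis Om_balanced : forall (c : R[i]) x, Normc.normc c <= 1 ->
  Om x -> Om (c *: x).
Hypothesis Om_absorbing : forall x, exists2 t : R, 0 < t & Om ((t^-1)%:C%C *: x).
Hypothesis Om_bounded : forall x, x != 0 -> exists2 e : R, 0 < e &
  forall t : R, 0 < t -> Om ((t^-1)%:C%C *: x) -> e <= t.

Let S x := [set t : R | 0 < t /\ Om ((t^-1)%:C%C *: x)].

Let S_neq0 x : S x !=set0.
Proof. by case: (Om_absorbing x) => t t0 tx; exists t; split. Qed.

Let mink_le x t : S x t -> minkowski Om x <= t.
Proof. by apply: ge_inf; exists 0 => s [/ltW]. Qed.

Let le_mink x e : (forall t, S x t -> e <= t) -> e <= minkowski Om x.
Proof. by move=> h; apply: lb_le_inf; [exact: S_neq0|move=> t /h]. Qed.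

Let mink_ge0 x : 0 <= minkowski Om x.
Proof. by apply: le_mink => t [/ltW]. Qed.

Lemma minkowskiD x y :
  minkowski Om (x + y) <= minkowski Om x + minkowski Om y.
Proof.
suff key s t : S x s -> S y t -> minkowski Om (x + y) <= s + t.
  rewrite -lerBlDr; apply: le_mink => s xs.
  rewrite lerBlDr -lerBlDl; apply: le_mink => t yt.
  by rewrite lerBlDl; exact: key.
move=> [s0 xs] [t0 yt]; apply: mink_le; split; first exact: addr_gt0.
have st0 : s + t != 0 by rewrite gt_eqF// addr_gt0.
have -> : ((s + t)^-1)%:C%C *: (x + y) =
    (s / (s + t))%:C%C *: ((s^-1)%:C%C *: x)
    + (t / (s + t))%:C%C *: ((t^-1)%:C%C *: y).
  have sE (a b : R) (z : 'cV[R[i]]_n) : 0 < a ->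
      (a / b)%:C%C *: ((a^-1)%:C%C *: z) = (b^-1)%:C%C *: z.
    by move=> a0; rewrite scalerA -rmorphM mulrAC divff ?gt_eqF// mul1r.
  by rewrite !sE// scalerDr.
apply: Om_convex => //; rewrite ?divr_ge0 ?addr_ge0 ?ltW//.
by rewrite -mulrDl divff.
Qed.

Let minkowskiZ_le (c : R[i]) x : c != 0 ->
  minkowski Om (c *: x) <= Normc.normc c * minkowski Om x.
Proof.
move=> c0; have nc0 : 0 < Normc.normc c.
  rewrite lt_neqAle normc_ge0 andbT eq_sym.
  by apply: contra c0 => /eqP/Normc.eq0_normc ->.
rewrite -ler_pdivrMl//; apply: le_mink => s [s0 xs].
rewrite ler_pdivrMl//; apply: mink_le; split; first exact: mulr_gt0.
have -> : ((Normc.normc c * s)^-1)%:C%C *: (c *: x) =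
    (((Normc.normc c)^-1)%:C%C * c) *: ((s^-1)%:C%C *: x).
  by rewrite invfM rmorphM /= !scalerA mulrAC.
apply: Om_balanced => //.
by rewrite Normc.normcM normc_real ?invr_ge0 ?normc_ge0// mulVf ?gt_eqF.
Qed.

Lemma minkowskiZ (c : R[i]) x :
  minkowski Om (c *: x) = Normc.normc c * minkowski Om x.
Proof.
have [->|c0] := eqVneq c 0.
  rewrite scale0r Normc.normc0 mul0r; apply/eqP; rewrite eq_le mink_ge0 andbT.
  apply/ler_addgt0Pr => e e0; rewrite add0r; apply: mink_le; split=> //.
  have [t _ Ot] := Om_absorbing 0.
  by move: Ot; rewrite !scaler0.
apply/eqP; rewrite eq_le minkowskiZ_le//=.
have nc0 : 0 < Normc.normc c.
  rewrite lt_neqAle normc_ge0 andbT eq_sym.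
  by apply: contra c0 => /eqP/Normc.eq0_normc ->.
rewrite -ler_pdivlMl// -Normc.normcV.
have := @minkowskiZ_le c^-1 (c *: x).
by rewrite scalerA mulVf// scale1r invr_eq0; exact.
Qed.

Lemma minkowski_eq0 x : minkowski Om x = 0 -> x = 0.
Proof.
move=> mx0; apply/eqP/negP => /negP/Om_bounded [e e0 h].
have : e <= minkowski Om x by apply: le_mink => t [t0]; exact: h.
by rewrite mx0 leNgt e0.
Qed.

End Minkowski.

Section Omega_norm.
Variables (R : realType) (p q : R).
Hypotheses (p1 : 1 <= p) (q1 : 1 <= q).

Let powR_convex (r a b x y : R) : 1 <= r -> 0 <= a -> 0 <= b -> a + b = 1 ->
  0 <= x -> 0 <= y -> (a * x + b * y) `^ r <= a * x `^ r + b * y `^ r.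
Proof.
move=> r1 a0 b0 ab x0 y0; have a1 : a <= 1 by lra.
have -> : b = 1 - a by lra.
by apply: (convex_powR r1 (Itv01 a0 a1)); rewrite inE /= in_itv /= ?x0 ?y0.
Qed.

Let entry_convex (r a b : R) (u v : R[i]) :
  1 <= r -> 0 <= a -> 0 <= b -> a + b = 1 ->
  Normc.normc (a%:C%C * u + b%:C%C * v) `^ r
  <= a * Normc.normc u `^ r + b * Normc.normc v `^ r.
Proof.
move=> r1 a0 b0 ab.
apply: le_trans (powR_convex r1 a0 b0 ab (normc_ge0 u) (normc_ge0 v)).
apply: ge0_ler_powR; rewrite ?nnegrE ?normc_ge0 ?addr_ge0 ?mulr_ge0 ?normc_ge0//.
  exact: le_trans r1.
by apply: le_trans (le_normcD _ _) _; rewrite !Normc.normcM !normc_real.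
Qed.

Lemma Omega_convex (a b : R) x y : 0 <= a -> 0 <= b -> a + b = 1 ->
  Omega p q x -> Omega p q y -> Omega p q (a%:C%C *: x + b%:C%C *: y).
Proof.
move=> a0 b0 ab; rewrite /Omega /= !mxE => Ox Oy.
apply: le_lt_trans (lerD (entry_convex _ _ p1 a0 b0 ab)
  (entry_convex _ _ q1 a0 b0 ab)) _.
set A := _ `^ p in Ox *; set B := _ `^ q in Ox *.
set C := _ `^ p in Oy *; set D := _ `^ q in Oy *.
have -> : a * A + b * C + (a * B + b * D) = a * (A + B) + b * (C + D) by lra.
have [a_eq0|a_neq0] := eqVneq a 0.
  have -> : b = 1 by lra.
  by rewrite a_eq0; lra.
have a_gt0 : 0 < a by rewrite lt_neqAle eq_sym a_neq0.
have h1 : a * (A + B) < a by rewrite gtr_pMr.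
have h2 : b * (C + D) <= b by rewrite ler_piMr// ltW.
lra.
Qed.

Lemma Omega_balanced (c : R[i]) x : Normc.normc c <= 1 ->
  Omega p q x -> Omega p q (c *: x).
Proof.
move=> c1; rewrite /Omega /= !mxE; apply: le_lt_trans.
by apply: lerD; apply: ge0_ler_powR;
  rewrite ?nnegrE ?normc_ge0 ?(le_trans ler01)// Normc.normcM ler_piMl ?normc_ge0.
Qed.

Let scaled_lt (t r : R) (u : R[i]) : 1 <= r -> 0 < t -> 2 * Normc.normc u < t ->
  Normc.normc ((t^-1)%:C%C * u) `^ r < 2^-1.
Proof.
move=> r1 t0 ut; rewrite Normc.normcM normc_real ?invr_ge0 ?ltW//.
have nu := normc_ge0 u.
have h : t^-1 * Normc.normc u < 2^-1 by rewrite ltr_pdivrMl//; lra.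
have h0 : 0 <= t^-1 * Normc.normc u by rewrite mulr_ge0// invr_ge0 ltW.
apply: le_lt_trans h.
move: h0; rewrite le_eqVlt => /predU1P[<-|h0].
  by rewrite powR0// gt_eqF// (lt_le_trans _ r1).
apply: ge1r_powR => //; rewrite h0 /=.
have := ltr_pdivrMl (Normc.normc u) 1 t0; rewrite -(ler_pM2l t0) mulVKf ?gt_eqF//; lra.
Qed.

Lemma Omega_absorbing x : exists2 t : R, 0 < t & Omega p q ((t^-1)%:C%C *: x).
Proof.
have n0 := normc_ge0 (x 0 0); have n1 := normc_ge0 (x 1 0).
pose t := 1 + 2 * Normc.normc (x 0 0) + 2 * Normc.normc (x 1 0).
have t0 : 0 < t by rewrite /t; lra.
exists t => //; rewrite /Omega /= !mxE.
have l1 : 2 * Normc.normc (x 0 0) < t by rewrite /t; lra.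
have l2 : 2 * Normc.normc (x 1 0) < t by rewrite /t; lra.
have := scaled_lt p1 t0 l1; have := scaled_lt q1 t0 l2; lra.
Qed.

Let entry_bound (t r : R) (u : R[i]) : 1 <= r -> 0 < t ->
  Normc.normc ((t^-1)%:C%C * u) `^ r < 1 -> Normc.normc u <= t.
Proof.
move=> r1 t0; have t0' : 0 <= t^-1 by rewrite invr_ge0 ltW.
rewrite Normc.normcM normc_real// => h; rewrite leNgt; apply/negP => tu.
move: h; apply/negP; rewrite -leNgt; have <- : 1 `^ r = 1 :> R by rewrite powR1.
have h : 1 <= t^-1 * Normc.normc u by rewrite ler_pdivlMl// mulr1 ltW.
by apply: ge0_ler_powR; rewrite ?nnegrE ?(le_trans ler01).
Qed.

Lemma Omega_bounded x : x != 0 -> exists2 e : R, 0 < e &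
  forall t : R, 0 < t -> Omega p q ((t^-1)%:C%C *: x) -> e <= t.
Proof.
move=> x0; exists (Num.max (Normc.normc (x 0 0)) (Normc.normc (x 1 0))).
  rewrite ltNge ge_max; apply: contra x0 => /andP[a b].
  have z (u : R[i]) : Normc.normc u <= 0 -> u = 0.
    by move=> u0; apply: Normc.eq0_normc; apply/eqP; rewrite eq_le u0 normc_ge0.
  apply/eqP/colP => i; rewrite mxE.
  have [->|->] : i = 0 \/ i = 1.
    by case: i => -[|[|//]] ?; [left|right]; exact: val_inj.
  - exact: z.
  - exact: z.
move=> t t0; rewrite /Omega /= !mxE => h; rewrite ge_max.
have h0 := powR_ge0 (Normc.normc ((t^-1)%:C%C * x 0 0)) p.
have h1 := powR_ge0 (Normc.normc ((t^-1)%:C%C * x 1 0)) q.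
by apply/andP; split; [apply: (entry_bound p1 t0)|apply: (entry_bound q1 t0)]; lra.
Qed.

(* The space (C^2, ||.||_Omega). *)
Definition Omega_space : banachCn R 2 :=
  BanachCn (minkowskiD Omega_convex Omega_absorbing)
    (minkowskiZ Omega_balanced Omega_absorbing)
    (minkowski_eq0 Omega_absorbing Omega_bounded).

Lemma Omega_space_ball : [set z | Omega_space z < 1] = Omega p q.
Proof.
apply/seteqP; split => z /=.
  apply: contraPP => nOz; apply/negP; rewrite -leNgt; apply: lb_le_inf.
    by case: (Omega_absorbing z) => t t0 tz; exists t; split.
  move=> t [t0 tz]; rewrite leNgt; apply/negP => t1; apply: nOz.
  have -> : z = t%:C%C *: ((t^-1)%:C%C *: z).
    by rewrite scalerA -rmorphM divff ?gt_eqF// scale1r.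
  by apply: Omega_balanced tz; rewrite normc_real ltW.
rewrite /Omega /= => Oz.
set u := Normc.normc (z 0 0) in Oz; set v := Normc.normc (z 1 0) in Oz.
have u0 : 0 <= u := normc_ge0 _.
have v0 : 0 <= v := normc_ge0 _.
have up0 := powR_ge0 u p; have vq0 := powR_ge0 v q.
set s := u `^ p + v `^ q in Oz.
pose m := Num.max p q; pose t := ((s + 1) / 2) `^ m^-1.
have m0 : 0 < m by rewrite lt_max !(lt_le_trans _ p1).
have s0 : 0 < (s + 1) / 2 by rewrite /s; lra.
have t0 : 0 < t by rewrite powR_gt0.
have tm : t `^ m = (s + 1) / 2 by rewrite -powRrM mulVf ?gt_eqF// powRr1// ltW.
have t1 : t < 1.
  have <- : 1 `^ m^-1 = 1 :> R by rewrite powR1.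
  by apply: gt0_ltr_powR; rewrite ?invr_gt0// ?nnegrE; lra.
have t01 : 0 < t <= 1 by rewrite t0 ltW.
have ti0 : 0 <= t^-1 by rewrite invr_ge0 ltW.
have bound (r : R) (w : R[i]) : 1 <= r -> r <= m ->
    Normc.normc ((t^-1)%:C%C * w) `^ r * t `^ m <= Normc.normc w `^ r.
  move=> r1 rm; rewrite Normc.normcM normc_real//.
  apply: (@le_trans _ _ ((t^-1 * Normc.normc w) `^ r * t `^ r)).
    by apply: ler_wpM2l; [exact: powR_ge0|exact: ger_powR].
  rewrite -powRM ?mulr_ge0 ?normc_ge0 ?(ltW t0)//.
  by rewrite mulrAC mulVf ?gt_eqF// mul1r.
apply: (@le_lt_trans _ _ t) => //; apply: ge_inf; first by exists 0 => x [/ltW].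
split=> //; rewrite /Omega /= !mxE.
have bp := bound p (z 0 0) p1; have bq := bound q (z 1 0) q1.
rewrite -(ltr_pM2r s0) mul1r -{1}tm mulrDl.
apply: (@le_lt_trans _ _ s); last by lra.
by apply: lerD; [apply: bp|apply: bq]; rewrite le_max lexx ?orbT.
Qed.

End Omega_norm.

(* Main.v *)
Require Import Defs.
From mathcomp Require Import all_boot all_order all_algebra.
From mathcomp Require Import all_classical all_reals all_analysis.
From mathcomp Require Import complex ring lra.
Import Order.TTheory GRing.Theory Num.Theory.
Local Open Scope ring_scope.

(** A positive semidefinite [A] has norm at most 1 from X to X* exactly when the
    ellipsoid [<Ax, x> <= 1] contains the unit ball of X.  Writing [B = S S*],
    the norm of [B] from X* to X is at most 1 exactly when the ellipsoid
    [S (Euclidean ball)] lies in the unit ball of X.  Hence a pair of ellipsoids,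
    one around the ball and one inside it, with [tr (A B) > 1], shows that
    gamma(X) > 1 ([not_propertyP_ellipsoids]).

    The domain Omega depends only on [|z1|] and [|z2|], and ellipsoids along the
    coordinate axes suffice.  In the coordinates [(x, y) = (|z1|^2, |z2|^2)],
    which turn Omega into [D = {x^(p/2) + y^(q/2) < 1}], [A] is the line
    [a0 x + a1 y = 1], which has to leave D on one side, and [B] is the segment
    from [(b0^2, 0)] to [(0, b1^2)], which has to stay in the closure of D.  Up to
    exchanging the coordinates there are two regimes.
    - If [q >= 2] ([ellipsoid_witness_ge2]), the closure of D contains the segment
      from [(1, 0)] to [(0, 1/4)].  Tilting the line [x = 1] to slope [a1 = delta]
      costs [delta / 16] in [a0], less than the gain [a1 b1^2 = delta / 4].
    - If [p, q < 2] and [q > 1] ([ellipsoid_witness_le2]), the Euclidean ball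
      contains Omega, so that [A] may be the identity.  At height [y] the boundary
      of D is at distance of order [y^(q/2)] from the line [x = 1], whereas the
      segment from [(1 - eps, 0)] to [(0, 4 eps)] is at distance of order
      [eps + y / eps], which is at least [sqrt y] up to a constant.  As [q > 1] the
      segment stays inside for small [eps], and its trace is [1 + 3 eps]. *)

Local Notation normc := Normc.normc.

(** * Moduli and scaling *)

Lemma normc_sum (R : realType) (I : finType) (F : I -> R[i]) :
  normc (\sum_i F i) <= \sum_i normc (F i).
Proof.
apply: (big_ind2 (fun (z : R[i]) r => normc z <= r)) => //.
  by rewrite Normc.normc0.
by move=> z r z' r' zr zr'; apply: le_trans (le_normcD _ _) (lerD zr zr').
Qed.

Lemma normc_conj (R : realType) (z : R[i]) : normc z^* = normc z.
Proof. by case: z => a b; rewrite /= sqrrN. Qed.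

Lemma mulr_conj_normc (R : realType) (z : R[i]) :
  z * z^* = (normc z ^+ 2)%:C%C.
Proof.
have := normCK z; rewrite -[`|z|]/((normc z)%:C%C) => <-.
by rewrite rmorphXn.
Qed.

(** Passes from open to closed balls: a homogeneous bound on the open ball
    extends to its closure. *)
Lemma le1_of_scaled {R : realType} (c : R) :
  (forall t, 0 < t < 1 -> t * c <= 1) -> c <= 1.
Proof.
move=> h; rewrite leNgt; apply/negP => c1.
have c0 : 0 < c by lra.
have ci : 0 < c^-1 < 1 by rewrite invr_gt0 c0 invf_lt1.
have t01 : 0 < (1 + c^-1) / 2 < 1 by apply/andP; split; lra.
by have := h _ t01; rewrite mulrAC mulrDl mul1r mulVf ?gt_eqF//; lra.
Qed.

(** * Diagonal ellipsoids and Property P *)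

Definition real_diag {R : realType} {n : nat} (a : 'I_n -> R) : 'M[R[i]]_n :=
  diag_mx (\row_i (a i)%:C%C).

Section Diagonal.
Context {R : realType} {n : nat}.
Implicit Types (a b : 'I_n -> R) (x z : 'cV[R[i]]_n) (X : banachCn R n).

Lemma real_diagE a x i : (real_diag a *m x) i 0 = (a i)%:C%C * x i 0.
Proof. by rewrite mul_diag_mx !mxE. Qed.

Lemma psdmx_real_diag a : (forall i, 0 <= a i) -> psdmx (real_diag a).
Proof.
move=> a0; split.
  apply/is_hermitianmxP; rewrite expr0 scale1r; apply/matrixP => i j.
  rewrite !mxE eq_sym; have [->|_] := eqVneq i j; rewrite ?mulr0n ?rmorph0//.
  by rewrite !mulr1n; apply/esym/conj_Creal; rewrite complex_real.
move=> x; rewrite -mulmxA mxE; apply: sumr_ge0 => i _.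
rewrite real_diagE !mxE mulrCA [_^* * _]mulrC mulr_conj_normc -rmorphM.
by rewrite lecR mulr_ge0 ?sqr_ge0.
Qed.

Lemma hs_inner_real_diag a b :
  hs_inner (real_diag a) (real_diag b) = (\sum_i a i * b i)%:C%C.
Proof.
rewrite /hs_inner rmorph_sum; apply: eq_bigr => i _.
rewrite (bigD1 i)//= big1 ?addr0 => [|j ji]; last first.
  by rewrite !mxE eq_sym (negPf ji) mulr0n mul0r.
rewrite !mxE eqxx !mulr1n rmorphM; congr (_ * _).
by apply/conj_Creal; rewrite complex_real.
Qed.

(** The sesquilinear form [<Ax, w>] is bounded by the mean of the quadratic form
    at [x] and at [w], by the arithmetic-geometric inequality in each
    coordinate. *)
Lemma op_norm_circumscribed X a : (forall i, 0 <= a i) ->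
  (forall x, X x <= 1 -> \sum_i a i * normc (x i 0) ^+ 2 <= 1) ->
  (op_norm (primal_norm X) (dual_norm X) (real_diag a) <= 1)%E.
Proof.
move=> a0 hA; apply: ge_ereal_sup => _ [x x1 <-].
apply: ge_ereal_sup => _ [w w1 <-]; rewrite lee_fin.
rewrite /primal_norm /= lee_fin in x1.
apply: le_trans (normc_sum _ _ _) _.
pose Q (v : 'cV[R[i]]_n) := \sum_i a i * normc (v i 0) ^+ 2.
have Qx1 : Q x <= 1 := hA _ x1; have Qw1 : Q w <= 1 := hA _ w1.
apply: (@le_trans _ _ ((Q x + Q w) / 2)); last by lra.
rewrite -big_split mulr_suml; apply: ler_sum => i _ /=.
rewrite real_diagE !Normc.normcM normc_conj normc_real//.
rewrite -mulrDr -!mulrA ler_wpM2l//.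
have := sqr_ge0 (normc (x i 0) - normc (w i 0)); nra.
Qed.

(** With [S = diag b], [S] is a contraction from the Euclidean space to X.  So is
    its adjoint, from X* to the Euclidean space: testing [z] against
    [S (S z / |S z|)], a vector of the unit ball of X, yields [|S z|]. *)
Lemma op_norm_inscribed X b :
  (forall y : 'cV[R[i]]_n, \sum_i normc (y i 0) ^+ 2 <= 1 ->
     X (real_diag b *m y) <= 1) ->
  (op_norm (dual_norm X) (primal_norm X) (real_diag (fun i => (b i ^+ 2)%R)) <= 1)%E.
Proof.
move=> hB; apply: ge_ereal_sup => _ [z z1 <-].
rewrite /primal_norm lee_fin.
have -> : real_diag (fun i => b i ^+ 2) *m z = real_diag b *m (real_diag b *m z).
  by apply/colP => i; rewrite !real_diagE mulrA -rmorphM.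
set y := real_diag b *m z; pose N : R := \sum_i normc (y i 0) ^+ 2.
have N0 : 0 <= N by apply: sumr_ge0 => i _; exact: sqr_ge0.
(* [s] is the Euclidean norm of [S z]. *)
pose s : R := Num.sqrt N.
have s2 : s ^+ 2 = N by rewrite sqr_sqrtr.
have [s_eq0|s_neq0] := eqVneq s 0.
  suff -> : y = 0 by rewrite mulmx0 -(scale0r 0) bnormZ Normc.normc0 mul0r.
  apply/colP => i; rewrite [RHS]mxE; apply: Normc.eq0_normc.
  have /psumr_eq0P : N = 0 by rewrite -s2 s_eq0 expr0n.
  move=> /(_ (fun i _ => sqr_ge0 _)) /(_ i isT) /eqP.
  by rewrite sqrf_eq0 => /eqP.
have s0 : 0 < s by rewrite lt_neqAle eq_sym s_neq0 sqrtr_ge0.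
pose v := (s^-1)%:C%C *: y.
have v1 : X (real_diag b *m v) <= 1.
  apply: hB; rewrite (_ : \sum_i _ = (s^-1) ^+ 2 * N).
    by rewrite -s2 -exprMn mulVf// expr1n.
  rewrite mulr_sumr; apply: eq_bigr => i _.
  by rewrite mxE Normc.normcM normc_real ?invr_ge0 ?ltW// exprMn.
have -> : real_diag b *m y = s%:C%C *: (real_diag b *m v).
  by rewrite -scalemxAr scalerA -rmorphM divff// scale1r.
rewrite bnormZ (normc_real (ltW s0)).
suff s1 : s <= 1 by apply: le_trans s1; rewrite ger_pMr.
have := z1; apply: contraTT; rewrite -!ltNge => s1.
apply: (lt_le_trans (y := (s%:E)%E)); first by rewrite lte_fin.
apply: ereal_sup_ubound; exists (real_diag b *m v) => //; congr (_%:E)%E.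
rewrite (_ : \sum_i _ = s%:C%C) ?normc_real ?ltW//.
have conj_real (t : R) : (t%:C%C : R[i])^* = t%:C%C.
  by apply/conj_Creal; rewrite complex_real.
have conjM (x' y' : R[i]) : (x' * y')^* = x'^* * y'^* by exact: rmorphM.
transitivity ((s^-1)%:C%C * \sum_i y i 0 * (y i 0)^* : R[i]).
  rewrite mulr_sumr; apply: eq_bigr => i _.
  rewrite [in LHS]real_diagE [in LHS]mxE [y i 0]real_diagE !conjM !conj_real.
  by ring.
rewrite (eq_bigr (fun i => (normc (y i 0) ^+ 2)%:C%C)) => [|i _]; last first.
  exact: mulr_conj_normc.
by rewrite -rmorph_sum -/N -s2 -rmorphM expr2 mulKf.
Qed.

Lemma not_propertyP_ellipsoids X a b : (forall i, 0 <= a i) ->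
  (forall x, X x <= 1 -> \sum_i a i * normc (x i 0) ^+ 2 <= 1) ->
  (forall y : 'cV[R[i]]_n, \sum_i normc (y i 0) ^+ 2 <= 1 ->
     X (real_diag b *m y) <= 1) ->
  1 < \sum_i a i * b i ^+ 2 -> ~ propertyP X.
Proof.
move=> a0 hA hB ab1 XP; have : (gammaX X <= 1)%E by rewrite XP.
apply/negP; rewrite -ltNge.
apply: (lt_le_trans (y := ((\sum_i a i * b i ^+ 2)%:E)%E)); first by rewrite lte_fin.
apply: ereal_sup_ubound; exists (real_diag a), (real_diag (fun i => b i ^+ 2)).
split; first exact: psdmx_real_diag.
- by apply: psdmx_real_diag => i; exact: sqr_ge0.
- exact: op_norm_circumscribed.
- exact: op_norm_inscribed.
- by rewrite hs_inner_real_diag.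
Qed.

End Diagonal.

(** * Ellipses around and inside the profile of Omega *)

Section Profile.
Context {R : realType}.
Implicit Types p q u v c d : R.

Lemma powR_anti u p q : 0 <= u <= 1 -> 0 < p -> p <= q -> u `^ q <= u `^ p.
Proof.
move=> /andP[]; rewrite le_eqVlt => /predU1P[<- _|u0 u1] p0 pq.
  by rewrite !powR0// gt_eqF// (lt_le_trans p0).
by apply: ger_powR => //; rewrite u0.
Qed.

Lemma powR_lt1 u p : 0 < p -> 0 <= u -> u `^ p < 1 -> u < 1.
Proof.
move=> p0 u0; apply: contraTT; rewrite -!leNgt => u1.
have <- : 1 `^ p = 1 :> R by rewrite powR1.
by apply: ge0_ler_powR; rewrite ?nnegrE// ltW.
Qed.

Lemma gt0_powRD u p q : 0 < u -> u `^ (p + q) = u `^ p * u `^ q.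
Proof. by move=> u0; rewrite powRD// (gt_eqF u0) implybT. Qed.

(** [a0, a1] are the entries of [A], while [b0, b1] are the semi-axes of the
    inscribed ellipsoid, so the entries of [B] are their squares.  The outer
    condition is needed only on the open domain, by homogeneity. *)
Definition ellipsoid_witness (p q a0 a1 b0 b1 : R) :=
  [/\ [/\ 0 <= a0, 0 <= a1, 0 <= b0 & 0 <= b1],
      forall u v, 0 <= u -> 0 <= v -> u `^ p + v `^ q < 1 ->
        a0 * u ^+ 2 + a1 * v ^+ 2 <= 1,
      forall c d, 0 <= c -> 0 <= d -> c ^+ 2 + d ^+ 2 <= 1 ->
        (b0 * c) `^ p + (b1 * d) `^ q <= 1
    & 1 < a0 * b0 ^+ 2 + a1 * b1 ^+ 2].

Lemma ellipsoid_witness_swap p q a0 a1 b0 b1 :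
  ellipsoid_witness p q a0 a1 b0 b1 -> ellipsoid_witness q p a1 a0 b1 b0.
Proof.
case=> -[? ? ? ?] hA hB ab; split=> //; last by rewrite addrC.
- by move=> u v u0 v0 uv; rewrite addrC; apply: hA => //; rewrite addrC.
- by move=> c d c0 d0 cd; rewrite addrC; apply: hB => //; rewrite addrC.
Qed.

(** The inscribed ellipsoid has semi-axes [1, 1/2]: for [q >= 2] and [d <= 1],
    [c^p + (d/2)^q <= c + d^2/4], and [d^2 <= 1 - c^2].  For the
    outer one, points with [v <= 1/4] allow the tilt [a0 = 1 - delta/16,
    a1 = delta]; points with [v > 1/4] have [u] bounded by some [r < 1], and
    [delta = 1 - r] leaves enough room. *)
Lemma ellipsoid_witness_ge2 p q : 1 <= p -> 2 <= q ->
  exists a0 a1 b0 b1, ellipsoid_witness p q a0 a1 b0 b1.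
Proof.
move=> p1 q2; have p0 : 0 < p by lra.
(* [u <= r] whenever [1/4 <= v] and [u^p + v^q < 1]. *)
pose h : R := 4^-1 `^ q; pose r := (1 - h) `^ p^-1.
have h0 : 0 < h by rewrite powR_gt0// invr_gt0; lra.
have h1 : h <= 1.
  rewrite -[leRHS](powRr0 4^-1); apply: ger_powR; last by lra.
  by apply/andP; split; lra.
have r0 : 0 <= r by exact: powR_ge0.
have r1 : r < 1.
  have one : 1 `^ p^-1 = 1 :> R by rewrite powR1.
  by rewrite -[ltRHS]one; apply: gt0_ltr_powR; rewrite ?invr_gt0 ?nnegrE//; lra.
exists (1 - (1 - r) / 16), (1 - r), 1, 2^-1; split; first by split; lra.
- move=> u v u0 v0 uv; have up := powR_ge0 u p; have vq := powR_ge0 v q.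
  have u1 : u < 1 by apply: (powR_lt1 _ _ p0 u0); lra.
  have v1 : v < 1 by apply: (powR_lt1 _ q _ v0); lra.
  have u2 : u ^+ 2 <= u by nra.
  have [v4|v4] := leP v 4^-1.
    have v2 : v ^+ 2 <= 16^-1 by nra.
    nra.
  have hv : h <= v `^ q by apply: ge0_ler_powR; rewrite ?nnegrE; lra.
  have ur : u <= r.
    rewrite -[u](powRr1 u0) -(@divff _ p) ?gt_eqF// powRrM.
    by apply: ge0_ler_powR; rewrite ?invr_ge0 ?nnegrE; lra.
  have v2 : (1 - r) * v ^+ 2 <= 1 - r by rewrite ler_piMr//; nra.
  have u3 : (1 - (1 - r) / 16) * u ^+ 2 <= u ^+ 2.
    by rewrite ler_piMl ?sqr_ge0//; lra.
  lra.
- move=> c d c0 d0 cd; rewrite mul1r.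
  have c1 : c <= 1 by nra.
  have d1 : d <= 1 by nra.
  have cp : c `^ p <= c.
    by rewrite -[leRHS](powRr1 c0); apply: powR_anti; rewrite ?c0//; lra.
  have dq : (2^-1 * d) `^ q <= (2^-1 * d) ^+ 2.
    by rewrite -powR_mulrn ?mulr_ge0//; apply: powR_anti => //; apply/andP; split; lra.
  nra.
- nra.
Qed.

(** The outer ellipsoid is the Euclidean ball.  The inscribed one has semi-axes
    [sqrt (1 - k^2)] and [2 k], with trace [1 + 3 k^2].  The first coordinate
    [s c] leaves room [1 - s c >= (1 - (s c)^2) / 2], which is at least of the
    order of [k^2 + d^2]; and [(k d)^q <= k^(2 (q - 1)) (k^2 + d^2)], where the
    first factor tends to 0 with [k] because [q > 1]. *)
Lemma ellipsoid_witness_le2 p q : 1 <= p <= 2 -> 1 < q <= 2 ->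
  exists a0 a1 b0 b1, ellipsoid_witness p q a0 a1 b0 b1.
Proof.
move=> /andP[p1 p2] /andP[q1 q2].
(* Chosen so that [k^(2 (q - 1)) = 1/64]. *)
pose k : R := 8^-1 `^ (q - 1)^-1.
have k0 : 0 < k by rewrite powR_gt0.
have kq : k `^ (q - 1) = 8^-1.
  by rewrite -powRrM mulVf ?powRr1//; lra.
have k1 : k <= 8^-1.
  rewrite -[leRHS]powRr1//; apply: ger_powR; first by apply/andP; split; lra.
  by rewrite -[leLHS]invr1 lef_pV2 ?posrE; lra.
have b0 : 0 <= 1 - k ^+ 2 by nra.
exists 1, 1, (Num.sqrt (1 - k ^+ 2)), (2 * k).
have sb := sqr_sqrtr b0; have s0 := sqrtr_ge0 (1 - k ^+ 2).
move: (Num.sqrt _) sb s0 => s sb s0.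
split; first by split=> //; lra.
- move=> u v u0 v0 uv; have up := powR_ge0 u p; have vq := powR_ge0 v q.
  have u1 : u < 1 by apply: (powR_lt1 _ p _ u0); lra.
  have v1 : v < 1 by apply: (powR_lt1 _ q _ v0); lra.
  have u2 : u ^+ 2 <= u `^ p by rewrite -powR_mulrn//; apply: powR_anti; lra.
  have v2 : v ^+ 2 <= v `^ q by rewrite -powR_mulrn//; apply: powR_anti; lra.
  lra.
- move=> c d c0 d0 cd.
  have sc0 : 0 <= s * c by exact: mulr_ge0.
  have sc1 : s * c <= 1 by nra.
  have scp : (s * c) `^ p <= s * c.
    by rewrite -[leRHS](powRr1 sc0); apply: powR_anti; rewrite ?sc0//; lra.
  have sc2 : s * c <= (1 + (s * c) ^+ 2) / 2.
    by have := sqr_ge0 (1 - s * c); nra.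
  have kd : (k * d) `^ q <= 64^-1 * (k ^+ 2 + d ^+ 2).
    (* [k^(2 - q) d^q <= m^2], using [0 <= 2 - q]. *)
    pose m := Num.max k d.
    have [km dm] : k <= m /\ d <= m by rewrite /m !le_max !lexx orbT.
    have m0 : 0 < m by lra.
    have m2 : m ^+ 2 <= k ^+ 2 + d ^+ 2.
      by rewrite /m; case: (leP k d) => _; have := sqr_ge0 k; have := sqr_ge0 d; lra.
    have -> : (k * d) `^ q = 64^-1 * (k `^ (2 - q) * d `^ q).
      rewrite powRM// ?ltW// mulrA; congr (_ * _).
      have -> : (64^-1 : R) = k `^ (q - 1) * k `^ (q - 1) by rewrite kq; lra.
      by rewrite -!gt0_powRD//; congr (_ `^ _); lra.
    rewrite ler_pM2l; last by lra.
    apply: le_trans m2; rewrite -(powR_mulrn 2); last exact: ltW.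
    rewrite -[in leRHS](subrK q 2%:R) [leRHS]gt0_powRD//.
    by apply: ler_pM; rewrite ?powR_ge0//; apply: ge0_ler_powR; rewrite ?nnegrE; lra.
  have kdq : (2 * k * d) `^ q <= 4 * (k * d) `^ q.
    rewrite -mulrA powRM//; last by rewrite mulr_ge0// ltW.
    rewrite ler_wpM2r ?powR_ge0//.
    have -> : (4 : R) = 2 `^ 2%:R by rewrite powR_mulrn//; lra.
    by apply: ler_powR; lra.
  have scE : (s * c) ^+ 2 = (1 - k ^+ 2) * c ^+ 2 by rewrite exprMn sb.
  nra.
- rewrite !mul1r sb; nra.
Qed.

Lemma exists_ellipsoid_witness p q : 1 <= p -> 1 <= q -> 1 < p \/ 1 < q ->
  exists a0 a1 b0 b1, ellipsoid_witness p q a0 a1 b0 b1.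
Proof.
have swap p' q' : (exists a0 a1 b0 b1, ellipsoid_witness p' q' a0 a1 b0 b1) ->
    exists a0 a1 b0 b1, ellipsoid_witness q' p' a0 a1 b0 b1.
  move=> [a0 [a1 [b0 [b1 w]]]].
  by exists a1, a0, b1, b0; exact: ellipsoid_witness_swap.
move=> p1 q1 pq.
have [q2|q2] := leP 2 q; first exact: ellipsoid_witness_ge2.
have [p2|p2] := leP 2 p; first by apply: swap; exact: ellipsoid_witness_ge2.
case: pq => [p1'|q1']; last by apply: ellipsoid_witness_le2; lra.
by apply: swap; apply: ellipsoid_witness_le2; lra.
Qed.

End Profile.

(** * The unit ball of the norm of Omega *)

Section OmegaBall.
Context {R : realType} {p q : R} (p1 : 1 <= p) (q1 : 1 <= q).
Implicit Type z : 'cV[R[i]]_2.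

Lemma Omega_space_lt1 z : Omega_space p1 q1 z < 1 <->
  normc (z 0 0) `^ p + normc (z 1 0) `^ q < 1.
Proof.
have := Omega_space_ball p1 q1 => /seteqP[h1 h2].
by split; [exact: h1|exact: h2].
Qed.

Lemma Omega_space_le1 z :
  normc (z 0 0) `^ p + normc (z 1 0) `^ q <= 1 -> Omega_space p1 q1 z <= 1.
Proof.
move=> z1; apply: le1_of_scaled => t /andP[t0 t1].
rewrite -[X in X * _](normc_real (ltW t0)) -bnormZ; apply/ltW/Omega_space_lt1.
have scaled (r : R) (w : R[i]) : 1 <= r ->
    normc (t%:C%C * w) `^ r <= t * normc w `^ r.
  move=> r1; rewrite Normc.normcM (normc_real (ltW t0)).
  rewrite powRM ?normc_ge0 ?(ltW t0)// ler_wpM2r ?powR_ge0//.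
  by apply: ge1r_powR; rewrite // t0 ltW.
rewrite !mxE; apply: le_lt_trans (lerD (scaled _ _ p1) (scaled _ _ q1)) _.
rewrite -mulrDr; apply: le_lt_trans t1.
by rewrite ger_pMr.
Qed.

End OmegaBall.

Theorem mainTheorem2 (R : realType) (p q : R) (p1 : 1 <= p) (q1 : 1 <= q)
    (pq : 1 < p \/ 1 < q) :
  ~ propertyP (Omega_space p1 q1).
Proof.
have [a0 [a1 [b0 [b1 [[a0_ge0 a1_ge0 b0_ge0 b1_ge0] hA hB ab]]]]] :=
  exists_ellipsoid_witness _ _ p1 q1 pq.
have sum2 (F : 'I_2 -> R) : \sum_i F i = F 0 + F 1.
  by rewrite !big_ord_recl big_ord0 addr0; congr (_ + F _); exact: val_inj.
pose a (i : 'I_2) := if i == 0 then a0 else a1.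
pose b (i : 'I_2) := if i == 0 then b0 else b1.
apply: (not_propertyP_ellipsoids _ a b).
- by move=> i; rewrite /a; case: ifP.
(* Scaling [x] by [sqrt t] scales the quadratic form by [t]. *)
- move=> x x1; apply: le1_of_scaled => t /andP[t0 t1]; rewrite sum2 /a /=.
  have st0 : 0 < Num.sqrt t by rewrite sqrtr_gt0.
  have st2 : Num.sqrt t ^+ 2 = t by rewrite sqr_sqrtr// ltW.
  have st1 : Num.sqrt t < 1 by rewrite -[ltRHS]sqrtr1 ltr_sqrt.
  have /Omega_space_lt1 : Omega_space p1 q1 ((Num.sqrt t)%:C%C *: x) < 1.
    rewrite bnormZ (normc_real (ltW st0)); apply: le_lt_trans st1.
    by rewrite ger_pMr.
  rewrite !mxE => /(hA _ _ (normc_ge0 _) (normc_ge0 _)).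
  rewrite !Normc.normcM (normc_real (ltW st0)) !exprMn st2; apply: le_trans.
  by rewrite le_eqVlt; apply/orP; left; apply/eqP; lra.
- move=> y; rewrite sum2 => y1; apply: Omega_space_le1.
  rewrite !real_diagE /b /= !Normc.normcM !normc_real//.
  exact: hB (normc_ge0 _) (normc_ge0 _) y1.
- by rewrite sum2.
Qed.
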